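(* For every integer $n\ge 1$, the braid group $B_n$ on $n$ components is torsion-free; that is, its only element of finite order is the identity.
   Context: $B_n$ denotes the standard (Artin) braid group on $n$ strands. *)

(* Defs.v *)
From HB Require Import structures.
From mathcomp Require Import all_boot.
From mathcomp Require Import boolp.

Set Implicit Arguments.
Unset Strict Implicit.
Unset Printing Implicit Defensive.

Local Open Scope group_scope.
Local Open Scope quotient_scope.

(* The letter (i, false) stands for the generator i, (i, true) for its inverse. *)
Notation word I := (seq (I * bool)).

Definition letter_inv (I : Type) (a : I * bool) : I * bool := (a.1, ~~ a.2).

Definition word_inv (I : Type) (w : word I) : word I := rev (map (@letter_inv I) w).

Section Presentation.
Variables (I : choiceType) (rels : word I -> word I -> Prop).

Inductive word_equiv : word I -> word I -> Prop :=
  | word_equiv_rel u v : rels u v -> word_equiv u v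
  | word_equiv_cancel a : word_equiv [:: a; letter_inv a] [::]
  | word_equiv_refl u : word_equiv u u
  | word_equiv_sym u v : word_equiv u v -> word_equiv v u
  | word_equiv_trans v u w :
      word_equiv u v -> word_equiv v w -> word_equiv u w
  | word_equiv_cat u u' v v' :
      word_equiv u u' -> word_equiv v v' -> word_equiv (u ++ v) (u' ++ v').

Definition word_equivb (u v : word I) : bool := `[< word_equiv u v >].

Lemma word_equivb_refl : reflexive word_equivb.
Proof. by move=> u; apply/asboolP; exact: word_equiv_refl. Qed.

Lemma word_equivb_sym : symmetric word_equivb.
Proof. by move=> u v; apply/asboolP/asboolP; exact: word_equiv_sym. Qed.

Lemma word_equivb_trans : transitive word_equivb.
Proof.
move=> v u w /asboolP uv /asboolP vw; apply/asboolP.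
exact: word_equiv_trans uv vw.
Qed.

Canonical word_equiv_equiv :=
  EquivRel word_equivb word_equivb_refl word_equivb_sym word_equivb_trans.

Definition presented_group := {eq_quot word_equivb}.

HB.instance Definition _ := Choice.on presented_group.
HB.instance Definition _ := EqQuotient.on presented_group.

Local Notation cl := \pi_presented_group.
Local Notation clW := (@quotW _ presented_group).

Lemma presented_eqP (u v : word I) :
  cl u = cl v <-> word_equiv u v.
Proof. by split=> [/eqmodP/asboolP|uv] //; apply/eqmodP/asboolP. Qed.

Lemma letter_invK : involutive (@letter_inv I).
Proof. by case=> i b; rewrite /letter_inv /= negbK. Qed.

Lemma word_equiv_catV (w : word I) : word_equiv (w ++ word_inv w) [::].
Proof.
elim: w => [|a w IHw]; first exact: word_equiv_refl.
have -> : (a :: w) ++ word_inv (a :: w)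
    = [:: a] ++ (w ++ word_inv w) ++ [:: letter_inv a].
  by rewrite /word_inv map_cons rev_cons -cats1 /= catA.
apply: word_equiv_trans (word_equiv_cancel a).
apply: (word_equiv_cat (word_equiv_refl [:: a])).
exact: (word_equiv_cat IHw (word_equiv_refl _)).
Qed.

Lemma word_invK : involutive (@word_inv I).
Proof. by move=> w; rewrite /word_inv map_rev revK mapK //; exact: letter_invK. Qed.

Lemma word_equiv_inv u v :
  word_equiv u v -> word_equiv (word_inv u) (word_inv v).
Proof.
move=> uv; rewrite -[word_inv u]cats0.
apply: (@word_equiv_trans (word_inv u ++ (v ++ word_inv v))).
  apply: word_equiv_cat; first exact: word_equiv_refl.
  exact/word_equiv_sym/word_equiv_catV.
rewrite catA -[X in word_equiv _ X]cat0s.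
apply: word_equiv_cat; last exact: word_equiv_refl.
apply: (@word_equiv_trans (word_inv u ++ u)).
  by apply: word_equiv_cat; [exact: word_equiv_refl | exact: word_equiv_sym].
by rewrite -{2}[u]word_invK; exact: word_equiv_catV.
Qed.

Definition presented_one : presented_group := cl [::].
Definition presented_mul (x y : presented_group) : presented_group :=
  cl (repr x ++ repr y).
Definition presented_inv (x : presented_group) : presented_group :=
  cl (word_inv (repr x)).

Lemma presented_reprP (u : word I) :
  word_equiv (repr (cl u)) u.
Proof. by apply/presented_eqP; rewrite reprK. Qed.

Lemma presented_mulE (u v : word I) :
  presented_mul (cl u) (cl v) = cl (u ++ v).
Proof. by apply/presented_eqP/word_equiv_cat; exact: presented_reprP. Qed.

Lemma presented_invE (u : word I) : presented_inv (cl u) = cl (word_inv u).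
Proof. by apply/presented_eqP/word_equiv_inv; exact: presented_reprP. Qed.

Lemma presented_mulA : associative presented_mul.
Proof.
by elim/clW=> u; elim/clW=> v;
  elim/clW=> w; rewrite !presented_mulE catA.
Qed.

Lemma presented_mul1 : left_id presented_one presented_mul.
Proof. by elim/clW=> u; rewrite presented_mulE. Qed.

Lemma presented_mulr1 : right_id presented_one presented_mul.
Proof. by elim/clW=> u; rewrite presented_mulE cats0. Qed.

Lemma presented_mulrV : right_inverse presented_one presented_inv presented_mul.
Proof.
elim/clW=> u; rewrite presented_invE presented_mulE.
exact/presented_eqP/word_equiv_catV.
Qed.

Lemma presented_mulV : left_inverse presented_one presented_inv presented_mul.
Proof.
elim/clW=> u; rewrite presented_invE presented_mulE.
by apply/presented_eqP; rewrite -{2}[u]word_invK; exact: word_equiv_catV.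
Qed.

HB.instance Definition _ := isGroup.Build presented_group
  presented_mulA presented_mul1 presented_mulr1 presented_mulV presented_mulrV.

End Presentation.

(* Artin's presentation. The generators sigma_1, ..., sigma_(n-1) are indexed
   from 0; for n = 0 and n = 1 there are none and the group is trivial. *)
Inductive artin_rel (n : nat) : word 'I_n.-1 -> word 'I_n.-1 -> Prop :=
  | artin_comm (i j : 'I_n.-1) : (i.+1 < j)%N ->
      artin_rel [:: (i, false); (j, false)] [:: (j, false); (i, false)]
  | artin_braid (i j : 'I_n.-1) : j = i.+1 :> nat ->
      artin_rel [:: (i, false); (j, false); (i, false)]
                [:: (j, false); (i, false); (j, false)].

Definition braid_group (n : nat) : groupType := presented_group (@artin_rel n).

Definition has_finite_order (G : groupType) (x : G) : Prop :=
  exists2 k : nat, (0 < k)%N & x ^+ k = 1.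

Definition torsion_free (G : groupType) : Prop :=
  forall x : G, has_finite_order x -> x = 1.

(* Main.v *)
From HB Require Import structures.
Require Import Defs.
From mathcomp Require Import all_boot.
From mathcomp Require Import boolp zify.

Set Implicit Arguments.
Unset Strict Implicit.
Unset Printing Implicit Defensive.

Local Open Scope group_scope.
Local Open Scope quotient_scope.

(** Braid groups are torsion-free because they carry a left-invariant partial
    order in which any two elements have a least upper bound. In such a group,
    if x ^+ k = 1 then the least upper bound y of the finite orbit
    1, x, ..., x ^+ k.-1 is moved by left translation by x to the least upper
    bound of the same orbit, so x * y = y and x = 1
    (join_order_torsion_free).

    The order is the one found by Garside: x <= y when y is x times a positive
    braid. Three facts about the monoid of positive braids, presented by the
    same generators and relations, make it a join order on the group
    (fractions_torsion_free).

    - Elements with a common right multiple have a least one, and cancellation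
      on the left is possible. Both follow from one statement (gen_mul_eq): an equality
      s_i * x = s_j * y in the monoid factors through the evident common
      multiple of s_i and s_j, which is s_i * s_j * s_i for neighbouring
      generators and s_i * s_j for distant ones. It is proved by induction on
      length; the only real work is to compose two such factorizations
      (cube), a finite computation inside the submonoids generated by three
      letters. The argument uses nothing about braids beyond the shape of the
      Coxeter graph, simply laced and without triangles, so it is carried out
      at that generality.

    - The full twist D = (s_1 ... s_m)^(m + 1) is central and a multiple of
      each generator, so any two positive braids have a common multiple.

    - The monoid embeds in the group and every group element becomes positive
      after multiplication by a power of D. Replacing each inverse letter
      s_i^-1 of a group word by the positive e_i with s_i * e_i = D, and
      counting the replacements, yields a numerator and an exponent; two words
      equal in the group have equal fractions in the monoid
      (numerator_equiv), which is what makes the embedding injective. *)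

(** * Torsion and join orders *)

Lemma join_order_torsion_free (G : groupType) (le : G -> G -> Prop) :
    (forall x, le x x) ->
    (forall x y z, le x y -> le y z -> le x z) ->
    (forall x y, le x y -> le y x -> x = y) ->
    (forall x y z, le x y -> le (z * x) (z * y)) ->
    (forall x y, exists m, forall u, le m u <-> le x u /\ le y u) ->
  torsion_free G.
Proof.
move=> le_refl le_trans le_anti leM le_join x [[//|k] _ xk1].
(* y is the least upper bound of the whole orbit of 1. *)
have [y yP] : exists y, forall u, le y u <-> forall i, i <= k -> le (x ^+ i) u.
  elim: k {xk1} => [|k [y yP]].
    exists 1 => u; split=> [le1u [|//] _|le1u]; first exact: le1u.
    exact: (le1u 0).
  have [m mP] := le_join y (x ^+ k.+1); exists m => u; rewrite mP yP.
  split=> [[le_u le_ku] i|le_u]; last by split=> [i ik|]; apply: le_u; lia.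
  by rewrite leq_eqVlt => /predU1P[->|] //; exact: le_u.
have le_pow_y i : i <= k -> le (x ^+ i) y by move: i; apply/yP.
have le_y_xy : le y (x * y).
  apply/yP=> -[|i] ik; last by rewrite expgS; apply/leM/le_pow_y/ltnW.
  by rewrite expg0 -xk1 expgS; apply/leM/le_pow_y.
(* Iterating y <= x * y once around the orbit gives the converse inequality. *)
have le_y_powy i : le y (x ^+ i * y).
  elim: i => [|i IHi]; first by rewrite expg0 mul1g.
  by apply: le_trans le_y_xy _; rewrite expgS -mulgA; exact: leM.
have le_xy_y : le (x * y) y.
  by rewrite -[X in le _ X]mul1g -xk1 expgS -mulgA; exact: leM.
by apply: (@mulIg _ y); rewrite mul1g; apply: le_anti.
Qed.

Definition ldvd (M : monoidType) (a b : M) : Prop := exists c, b = a * c.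

Definition is_lcm (M : monoidType) (a b m : M) : Prop :=
  forall z, ldvd m z <-> ldvd a z /\ ldvd b z.

(** In the order on the group, x <= y when y is x times an element of the monoid;
    it is antisymmetric because the monoid has no nontrivial invertible elements.
    Two elements of the group are moved into the monoid by one common left
    translation, which preserves the order, and there an lcm is a least upper
    bound. *)
Lemma fractions_torsion_free (M : monoidType) (G : groupType) (f : M -> G) :
    {morph f : a b / a * b} -> injective f ->
    (forall a b : M, a * b = 1 -> a = 1) ->
    (forall a b : M, exists m, is_lcm a b m) ->
    (forall x, exists d p, f d * x = f p) ->
  torsion_free G.
Proof.
move=> fM f_inj conical lcmP fracP.
have f1 : f 1 = 1 by apply: (@mulgI _ (f 1)); rewrite -fM !mulg1.
apply: (@join_order_torsion_free G (fun x y => exists c, y = x * f c)).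
- by move=> x; exists 1; rewrite f1 mulg1.
- by move=> x _ _ [c ->] [d ->]; exists (c * d); rewrite fM mulgA.
- move=> x _ [c ->] [d]; rewrite -mulgA -fM -[LHS]mulg1 => /mulgI.
  by rewrite -f1 => /f_inj/esym/conical ->; rewrite f1 mulg1.
- by move=> x _ z [c ->]; exists c; rewrite mulgA.
(* e * d is a common left denominator of x and y. *)
move=> x y; have [d [p dx]] := fracP x; have [e [q edy]] := fracP (f d * y).
have {}dx : x = (f (e * d))^-1 * f (e * p).
  by rewrite !fM -dx (mulgA (f e)) mulKg.
have {edy}dy : y = (f (e * d))^-1 * f q by rewrite -edy fM (mulgA (f e)) mulKg.
have [m mP] := lcmP (e * p) q; exists ((f (e * d))^-1 * f m) => u; split.
  case=> c ->; have [[a ea] [b qb]] : ldvd (e * p) m /\ ldvd q m.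
    by apply/mP; exists 1; rewrite mulg1.
  split; [exists (a * c) | exists (b * c)].
    by rewrite dx ea !fM !mulgA.
  by rewrite dy qb !fM !mulgA.
case=> -[a ua] [b ub].
have /mP[c zc] : ldvd (e * p) (e * p * a) /\ ldvd q (e * p * a).
  split; first by exists a.
  exists b; apply: f_inj; apply: (@mulgI _ (f (e * d))^-1).
  by rewrite (fM _ a) (fM q) !mulgA -dx -dy -ua -ub.
by exists c; rewrite -mulgA -fM -zc (fM _ a) mulgA -dx.
Qed.

(** * Simply laced Artin monoids *)

Section ArtinMonoid.

Variables (T : choiceType) (adj : rel T).

Inductive artin_equiv : seq T -> seq T -> Prop :=
  | artin_equiv_comm i j : ~~ adj i j -> artin_equiv [:: i; j] [:: j; i]
  | artin_equiv_braid i j : adj i j -> artin_equiv [:: i; j; i] [:: j; i; j]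
  | artin_equiv_refl u : artin_equiv u u
  | artin_equiv_sym u v : artin_equiv u v -> artin_equiv v u
  | artin_equiv_trans v u w :
      artin_equiv u v -> artin_equiv v w -> artin_equiv u w
  | artin_equiv_cat u u' v v' :
      artin_equiv u u' -> artin_equiv v v' -> artin_equiv (u ++ v) (u' ++ v').

Definition artin_equivb (u v : seq T) : bool := `[< artin_equiv u v >].

Lemma artin_equivb_refl : reflexive artin_equivb.
Proof. by move=> u; apply/asboolP; exact: artin_equiv_refl. Qed.

Lemma artin_equivb_sym : symmetric artin_equivb.
Proof. by move=> u v; apply/asboolP/asboolP; exact: artin_equiv_sym. Qed.

Lemma artin_equivb_trans : transitive artin_equivb.
Proof.
move=> v u w /asboolP uv /asboolP vw; apply/asboolP.
exact: artin_equiv_trans uv vw.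
Qed.

Canonical artin_equiv_equiv :=
  EquivRel artin_equivb artin_equivb_refl artin_equivb_sym artin_equivb_trans.

Definition artin_monoid := {eq_quot artin_equivb}.

HB.instance Definition _ := Choice.on artin_monoid.
HB.instance Definition _ := EqQuotient.on artin_monoid.

Definition mcl (u : seq T) : artin_monoid := \pi_artin_monoid u.

Lemma mcl_eqP u v : mcl u = mcl v <-> artin_equiv u v.
Proof. by split=> [/eqmodP/asboolP|uv] //; apply/eqmodP/asboolP. Qed.

Lemma mcl_surj (x : artin_monoid) : exists u, x = mcl u.
Proof. by exists (repr x); rewrite /mcl reprK. Qed.

Definition artin_one := mcl [::].
Definition artin_mul (x y : artin_monoid) := mcl (repr x ++ repr y).

Lemma repr_mcl u : artin_equiv (repr (mcl u)) u.
Proof. by apply/mcl_eqP; rewrite /mcl reprK. Qed.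

Lemma artin_mulE u v : artin_mul (mcl u) (mcl v) = mcl (u ++ v).
Proof. by apply/mcl_eqP/artin_equiv_cat; exact: repr_mcl. Qed.

Lemma artin_mulA : associative artin_mul.
Proof.
move=> x y z; have [u ->] := mcl_surj x; have [v ->] := mcl_surj y.
by have [w ->] := mcl_surj z; rewrite !artin_mulE catA.
Qed.

Lemma artin_mul1 : left_id artin_one artin_mul.
Proof. by move=> x; have [u ->] := mcl_surj x; rewrite artin_mulE. Qed.

Lemma artin_mulr1 : right_id artin_one artin_mul.
Proof. by move=> x; have [u ->] := mcl_surj x; rewrite artin_mulE cats0. Qed.

HB.instance Definition _ := isMonoid.Build artin_monoid
  artin_mulA artin_mul1 artin_mulr1.

Local Notation M := artin_monoid.

Lemma mclM u v : mcl (u ++ v) = mcl u * mcl v.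
Proof. exact/esym/artin_mulE. Qed.

Definition gen (i : T) : M := mcl [:: i].

Lemma mcl_cons i u : mcl (i :: u) = gen i * mcl u.
Proof. by rewrite -mclM. Qed.

Lemma mcl_nil : mcl [::] = 1.
Proof. by []. Qed.

Lemma artin_ind (P : M -> Prop) :
  P 1 -> (forall i x, P x -> P (gen i * x)) -> forall x, P x.
Proof.
move=> P1 PS x; have [u ->] := mcl_surj x.
by elim: u => [|i u IHu] //; rewrite mcl_cons; exact: PS.
Qed.

Lemma gen_comm i j x :
  ~~ adj i j -> gen i * (gen j * x) = gen j * (gen i * x).
Proof.
move=> nij; have /mcl_eqP/(congr1 ( *%g^~ x)) := artin_equiv_comm nij.
by rewrite !mcl_cons mcl_nil !mulg1 -!mulgA.
Qed.

Lemma gen_braid i j x : adj i j ->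
  gen i * (gen j * (gen i * x)) = gen j * (gen i * (gen j * x)).
Proof.
move=> aij; have /mcl_eqP/(congr1 ( *%g^~ x)) := artin_equiv_braid aij.
by rewrite !mcl_cons mcl_nil !mulg1 -!mulgA.
Qed.

Lemma artin_equiv_size u v : artin_equiv u v -> size u = size v.
Proof.
elim=> // [v' u' w _ -> _ -> //|u1 u2 v1 v2 _ IHu _ IHv].
by rewrite !size_cat IHu IHv.
Qed.

Definition len (x : M) : nat := size (repr x).

Lemma len_mcl u : len (mcl u) = size u.
Proof. exact/artin_equiv_size/repr_mcl. Qed.

Lemma lenM x y : len (x * y) = (len x + len y)%N.
Proof.
have [u ->] := mcl_surj x; have [v ->] := mcl_surj y.
by rewrite -mclM !len_mcl size_cat.
Qed.

Lemma len_gen i : len (gen i) = 1%N.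
Proof. exact: len_mcl. Qed.

(** The defining relations preserve the length of words, so an equation in the
    monoid gives an equation between lengths; this discharges the length bounds
    of the inductions below. *)
Ltac len_lia :=
  repeat match goal with
  | H : @eq nat _ _ |- _ => revert H
  | H : is_true (leq _ _) |- _ => revert H
  | H : _ = _ |- _ => move: (congr1 len H); clear H
  end;
  rewrite ?lenM ?len_gen; clear; lia.

Lemma len_eq0 x : len x = 0%N -> x = 1.
Proof. by have [u ->] := mcl_surj x; rewrite len_mcl => /size0nil->. Qed.

Lemma artin_conical (x y : M) : x * y = 1 -> x = 1.
Proof.
move=> /(congr1 len); rewrite lenM [len 1]len_mcl /= => xy0.
by apply: len_eq0; lia.
Qed.

(** gen i * compl i j is the least common multiple of gen i and gen j. *)
Definition compl (i j : T) : M :=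
  if i == j then 1 else if adj i j then gen j * gen i else gen j.

(** The factorization that an equation gen i * x = gen j * y is to have through
    the least common multiple of gen i and gen j. *)
Definition split_heads (i j : T) (x y : M) : Prop :=
  exists z, x = compl i j * z /\ y = compl j i * z.

Lemma compl_id i : compl i i = 1.
Proof. by rewrite /compl eqxx. Qed.

Lemma split_heads_id i x : split_heads i i x x.
Proof. by exists x; rewrite compl_id mul1g. Qed.

Lemma split_heads_sym i j x y : split_heads i j x y -> split_heads j i y x.
Proof. by case=> z [xz yz]; exists z. Qed.

Hypothesis adj_sym : symmetric adj.
Hypothesis adj_triangle : forall i j k, adj i j -> adj j k -> ~~ adj i k.

Lemma adj_irr i : adj i i = false.
Proof. by apply/negP=> aii; move: (adj_triangle aii aii); rewrite aii. Qed.

Lemma adj_neq i j : adj i j -> i != j.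
Proof. by apply: contraTneq => ->; rewrite adj_irr. Qed.

Lemma compl_adj i j : adj i j -> compl i j = gen j * gen i.
Proof. by move=> aij; rewrite /compl aij (negPf (adj_neq aij)). Qed.

Lemma compl_nadj i j : i != j -> ~~ adj i j -> compl i j = gen j.
Proof. by rewrite /compl => /negPf-> /negPf->. Qed.

Lemma gen_compl i j : gen i * compl i j = gen j * compl j i.
Proof.
rewrite /compl [j == i]eq_sym; have [-> //|_] := eqVneq i j.
rewrite [adj j i]adj_sym; case: ifPn => [aij|nij].
  by have := gen_braid 1 aij; rewrite !mulg1.
by have := gen_comm 1 nij; rewrite !mulg1.
Qed.

(** * Left cancellation and the cube condition *)

Section Cube.

Variable s : nat.
Hypothesis IHs : forall i j x y,
  len x < s -> gen i * x = gen j * y -> split_heads i j x y.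

Lemma short_cancel i x y : len x < s -> gen i * x = gen i * y -> x = y.
Proof. by move=> xs /(IHs xs)[z []]; rewrite compl_id mul1g => -> ->. Qed.

Lemma short_comm i j x y : len x < s -> i != j -> ~~ adj i j ->
  gen i * x = gen j * y -> exists z, x = gen j * z /\ y = gen i * z.
Proof.
move=> xs neq nij /(IHs xs)[z [-> ->]]; exists z.
by rewrite !compl_nadj // 1?adj_sym 1?eq_sym.
Qed.

Lemma short_braid i j x y : len x < s -> adj i j ->
  gen i * x = gen j * y ->
  exists z, x = gen j * (gen i * z) /\ y = gen i * (gen j * z).
Proof.
move=> xs aij /(IHs xs)[z [-> ->]]; exists z.
by rewrite !compl_adj // 1?adj_sym // !mulgA.
Qed.

(** Composing the factorizations of gen i * X = gen k * V and of
    gen k * V = gen j * Y, where X = compl i k * x, Y = compl j k * y and V is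
    the common value of compl k i * x and compl k j * y. The tail V is shorter
    than the words being compared, so the equation for V can itself be taken
    apart by induction; each shape of the graph on i, j and k then leaves a word
    computation. Three pairwise adjacent generators have no common multiple, so
    for them no word computation could produce one: adj_triangle excludes that
    shape. *)
Lemma cube i j k x y : len (compl k i * x) = s ->
    compl k i * x = compl k j * y ->
  split_heads i j (compl i k * x) (compl j k * y).
Proof.
wlog adj_jik : i j x y / adj j k -> adj i k.
  move=> IH; case aik: (adj i k); first by apply: IH; rewrite aik.
  move=> xs xy; apply/split_heads_sym/IH; rewrite ?aik //.
  by rewrite -xy.
have [->|neqik] := eqVneq i k.
  by rewrite !compl_id !mul1g => _ ->; exists y.
have [->|neqjk] := eqVneq j k.
  rewrite !compl_id !mul1g => _ <-; exists x; by [].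
have [<-|neqij] := eqVneq i j.
  move=> xs xy; suff -> : x = y by exact: split_heads_id.
  move: xs xy; rewrite /compl eq_sym (negPf neqik); case: ifP => _.
    rewrite -!mulgA !lenM !len_gen => xs xy.
    apply: (short_cancel (i := k)); first by lia.
    by apply: (short_cancel (i := i)) xy; rewrite lenM len_gen; lia.
  rewrite !lenM !len_gen => xs xy.
  by apply: (short_cancel (i := i)) xy; lia.
have [neqki neqkj neqji] : [/\ k != i, k != j & j != i] by split; rewrite eq_sym.
have [aki akj aji] : [/\ adj k i = adj i k, adj k j = adj j k & adj j i = adj i j].
  by split; rewrite adj_sym.
rewrite /split_heads /compl (negPf neqik) (negPf neqjk) (negPf neqij).
rewrite (negPf neqki) (negPf neqkj) (negPf neqji) aki akj aji.
have [aik|nik] := boolP (adj i k); have [ajk|njk] := boolP (adj j k).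
(* The path i - k - j. *)
- have nij : ~~ adj i j by apply: (adj_triangle aik); rewrite akj.
  rewrite (negPf nij) -!mulgA !lenM !len_gen => xs xy.
  rewrite ajk in akj; rewrite aik in aki.
  have [|w [kx ky]] := short_comm _ neqij nij xy; first by len_lia.
  have [|u [ex ew]] := short_braid _ akj kx; first by len_lia.
  have [|u' [ey ew']] := short_braid _ aki ky; first by len_lia.
  have juiu' : gen j * u = gen i * u'.
    by apply: (@short_cancel k); [len_lia | rewrite -ew].
  rewrite -aji in nij.
  have [|q [eu eu']] := short_comm _ neqji nij juiu'; first by len_lia.
  exists (gen k * (gen j * (gen i * (gen k * q)))); rewrite ex ey eu eu'.
  split; first by rewrite -(gen_comm _ nij) (gen_braid _ aik) (gen_braid _ akj).
  by rewrite !(gen_comm _ nij) (gen_braid _ ajk) (gen_braid _ aki).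
(* The path k - i - j, or the edge i - k with j isolated. *)
- rewrite -!mulgA !lenM !len_gen => xs; rewrite aik in aki; rewrite -akj in njk.
  case: ifPn => [aij|nij] xy.
    have [|w [kx ->]] := short_braid _ aij xy; first by len_lia.
    have [|v [-> iw]] := short_comm _ neqkj njk kx; first by len_lia.
    have [|u [-> ->]] := short_braid _ aik iw; first by len_lia.
    exists (gen k * (gen i * (gen j * u))); rewrite -!mulgA; split.
      rewrite (gen_braid _ aij) (gen_comm _ njk) -(gen_comm u njk).
      by rewrite (gen_braid _ aki).
    rewrite -(gen_comm (gen i * u) njk) (gen_braid _ aki) (gen_braid _ aij).
    by rewrite (gen_comm _ njk).
  have [|w [kx ->]] := short_comm _ neqij nij xy; first by len_lia.
  have [|u [-> ->]] := short_comm _ neqkj njk kx; first by len_lia.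
  exists (gen k * (gen i * u)).
  by rewrite (gen_comm _ nij) (gen_comm _ njk) (gen_braid _ aki).
- by rewrite (adj_jik ajk) in nik.
(* k commutes with both i and j. *)
rewrite -aki in nik; rewrite -akj in njk.
rewrite !lenM !len_gen => xs; case: ifPn => [aij|nij] xy.
  have [|w [-> ->]] := short_braid _ aij xy; first by len_lia.
  exists (gen k * w); rewrite -!mulgA.
  by rewrite !(gen_comm _ nik, gen_comm _ njk).
have [|w [-> ->]] := short_comm _ neqij nij xy; first by len_lia.
by exists (gen k * w); rewrite (gen_comm _ nik) (gen_comm _ njk).
Qed.

End Cube.

Lemma split_heads_trans s i k j x v y :
    (forall i j x y, len x < s -> gen i * x = gen j * y -> split_heads i j x y) ->
    len v <= s -> split_heads i k x v -> split_heads k j v y ->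
  split_heads i j x y.
Proof.
move=> IHs vs [z [-> vz]] [z' [vz' ->]].
apply: (@cube (len v)); last by rewrite -vz.
  by move=> i' j' x' y' xs; apply: IHs; apply: leq_trans vs.
by rewrite -vz.
Qed.

Definition heads_split (u v : seq T) : Prop :=
  match u, v with
  | i :: u', j :: v' => split_heads i j (mcl u') (mcl v')
  | [::], [::] => True
  | _, _ => False
  end.

(** Induction on the derivation of u ~ v, at a fixed bound on the length. A
    relation applied away from the head leaves the head alone, one applied at the
    head has the required form with the rest of the word as remainder, and transitivity is the
    cube condition. *)
Lemma artin_equiv_heads_split s u v :
    (forall i j x y, len x < s -> gen i * x = gen j * y -> split_heads i j x y) ->
  artin_equiv u v -> size u <= s.+1 -> heads_split u v.
Proof.
move=> IHs; elim=> {u v} /=.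
- move=> i j nij _; have [->|neqij] := eqVneq i j; first exact: split_heads_id.
  by exists 1; rewrite !compl_nadj // 1?eq_sym 1?adj_sym // !mulg1.
- move=> i j aij _; exists 1.
  by rewrite !compl_adj // 1?adj_sym // !mulg1 !mcl_cons mcl_nil !mulg1.
- by case=> //= i u _; exact: split_heads_id.
- move=> u v uv IHuv vs; move: IHuv; rewrite (artin_equiv_size uv) => /(_ vs).
  by case: u v {uv vs} => [|i u] [|j v] //=; exact: split_heads_sym.
- move=> v u w uv IHuv vw IHvw us; have uvs := artin_equiv_size uv.
  rewrite -uvs in IHvw; move: (IHuv us) (IHvw us) uvs (us).
  case: u v w {uv vw IHuv IHvw us} => [|i u] [|k v] [|j w] //= uv vw [uvs] us.
  by apply: (split_heads_trans IHs) uv vw; rewrite len_mcl -uvs.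
move=> u u' v v' uu' IHu vv' IHv; rewrite size_cat => uvs.
have {}/IHu : size u <= s.+1 by lia.
have {IHv} : heads_split v v' by apply: IHv; lia.
case: u u' {uu' uvs} => [|i u] [|j u'] //= _ [z [uz u'z]].
exists (z * mcl v); rewrite !mclM uz u'z -!mulgA; split=> //.
by rewrite (mcl_eqP v v').2.
Qed.

Lemma gen_mul_eq i j x y : gen i * x = gen j * y -> split_heads i j x y.
Proof.
have [s] := ubnP (len x); elim: s => // s IHs in i j x y *.
rewrite ltnS => xs; have [u xu] := mcl_surj x; have [v yv] := mcl_surj y.
rewrite xu yv -!mcl_cons => /mcl_eqP uv.
have us : size (i :: u) <= s.+1 by rewrite /= -len_mcl -xu.
exact: (artin_equiv_heads_split IHs uv us).
Qed.

Lemma artin_cancel (a : M) : injective (mul a).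
Proof.
elim/artin_ind: a => [|i a IHa] x y; first by rewrite !mul1g.
by rewrite -!mulgA => /gen_mul_eq[z []]; rewrite compl_id mul1g => <- /IHa.
Qed.

(** * Least common multiples *)

(** If lcm(a, c) = c * p, then p is the least element whose product with c on
    the left is a multiple of a. *)
Lemma lcm_residual (a c m : M) :
  is_lcm a c m -> exists p, forall w, ldvd p w <-> ldvd a (c * w).
Proof.
move=> mP; have [[a' ma] [p mc]] : ldvd a m /\ ldvd c m.
  by apply/mP; exists 1; rewrite mulg1.
exists p => w; split=> [[t ->]|aw].
  by exists (a' * t); rewrite mulgA -mc ma mulgA.
have /mP[t] : ldvd a (c * w) /\ ldvd c (c * w) by split=> //; exists w.
by rewrite mc -mulgA => /artin_cancel ->; exists t.
Qed.

(** Euclid-style recursion on the length of a common multiple. A common multiple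
    of gen i * a and gen j * b is gen i * compl i j * w = gen j * compl j i * w,
    and by cancellation the condition on w is that a divides compl i j * w and b
    divides compl j i * w. By induction each of these says that w is a multiple
    of a fixed residual, and the lcm of the two residuals gives the answer. *)
Lemma common_multiple_lcm (a b c : M) :
  ldvd a c -> ldvd b c -> exists m, is_lcm a b m.
Proof.
have [s] := ubnP (len c); elim: s => // s IHs in a b c *; rewrite ltnS => cs.
elim/artin_ind: a => [_ _|i a _ [d cd]].
  by exists b => z; split=> [|[]//]; split=> //; exists z; rewrite mul1g.
elim/artin_ind: b => [_|j b _ [e ce]].
  exists (gen i * a) => z; split=> [|[]//]; split=> //; exists z.
  by rewrite mul1g.
move: (ce); rewrite cd -!mulgA => /gen_mul_eq[z [adz bez]].
have lt_s : len (compl i j * z) < s by rewrite -adz; len_lia.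
have lt_s' : len (compl j i * z) < s by rewrite -bez; len_lia.
have [||p /lcm_residual[p' p'P]] := IHs a (compl i j) _ lt_s;
  [by exists d | by exists z |].
have [||q /lcm_residual[q' q'P]] := IHs b (compl j i) _ lt_s';
  [by exists e | by exists z |].
have [|||r rP] := IHs p' q' z.
- by move: lt_s; rewrite lenM; apply: leq_ltn_trans (leq_addl _ _).
- by apply/p'P; exists d.
- by apply/q'P; exists e.
exists (gen i * compl i j * r) => w; split=> [[t ->]|[[u wu] [v wv]]].
  have /rP[/p'P[u pu] /q'P[v qv]] : ldvd r (r * t) by exists t.
  split; [exists u | exists v].
    by rewrite -!mulgA pu.
  by rewrite gen_compl -!mulgA qv.
move: (wv); rewrite wu -!mulgA => /gen_mul_eq[t [aut bvt]].
have /rP[x tx] : ldvd p' t /\ ldvd q' t.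
  by split; [apply/p'P; exists u | apply/q'P; exists v].
by exists x; rewrite -!mulgA aut tx.
Qed.

End ArtinMonoid.

(** * The full twist *)

Section FullTwist.

Variables (M : monoidType) (m : nat) (s : nat -> M).
Hypothesis s_comm : forall k l, k.+1 < l < m -> commute (s k) (s l).
Hypothesis s_braid : forall k, k.+1 < m ->
  s k * (s k.+1 * s k) = s k.+1 * (s k * s k.+1).

Definition chain : M := \prod_(0 <= i < m) s i.

(** Conjugation by the chain moves each generator to the next one. *)
Lemma chain_shift k : k.+1 < m -> chain * s k = s k.+1 * chain.
Proof.
move=> km.
have -> : chain = \prod_(0 <= i < k) s i *
    (s k * (s k.+1 * \prod_(k.+2 <= i < m) s i)).
  by rewrite -!big_ltn -?big_cat_nat //; lia.
have skC : commute (s k) (\prod_(k.+2 <= i < m) s i).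
  by rewrite big_nat; apply: commute_prod => i; apply: s_comm.
have sSkC : commute (s k.+1) (\prod_(0 <= i < k) s i).
  rewrite big_nat; apply: commute_prod => i ik.
  by apply/commute_sym/s_comm; lia.
rewrite -!mulgA -skC [RHS]mulgA sSkC -!mulgA; congr (_ * _).
have /(congr1 ( *%g^~ (\prod_(k.+2 <= i < m) s i))) := s_braid km.
by rewrite -!mulgA.
Qed.

Lemma chain_shiftX j k : k + j < m -> chain ^+ j * s k = s (k + j) * chain ^+ j.
Proof.
elim: j k => [|j IHj] k kjm; first by rewrite addn0 expg0 mulg1 mul1g.
rewrite expgSr -mulgA chain_shift ?mulgA; last by lia.
by rewrite IHj -?mulgA ?addSnnS //; lia.
Qed.

Lemma chain_prod_shift j : j < m ->
  chain * \prod_(0 <= i < j) s i = \prod_(0 <= i < j) s i.+1 * chain.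
Proof.
elim: j => [|j IHj] jm; first by rewrite !big_nil mul1g mulg1.
by rewrite !big_nat_recr //= mulgA IHj -?mulgA ?chain_shift //; lia.
Qed.

(** The last generator returns to the first after two conjugations by the chain,
    so that conjugation by the chain to the power m + 1 fixes every generator. *)
Lemma chain2_wrap : 0 < m -> chain * chain * s m.-1 = s 0 * (chain * chain).
Proof.
move=> m_gt0; have chain_recl : chain = s 0 * \prod_(0 <= i < m.-1) s i.+1.
  by rewrite -big_nat_recl // prednK.
have chain_recr : chain = \prod_(0 <= i < m.-1) s i * s m.-1.
  by rewrite -big_nat_recr // prednK.
have shift : chain * \prod_(0 <= i < m.-1) s i =
    \prod_(0 <= i < m.-1) s i.+1 * chain.
  by apply: chain_prod_shift; rewrite prednK.
rewrite [in RHS]mulgA [X in _ = _ * _ * X]chain_recr.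
by rewrite -[RHS]mulgA [chain * (_ * _)]mulgA shift !mulgA -chain_recl.
Qed.

Definition full_twist : M := chain ^+ m.+1.

(** s k climbs to s m.-1 in m.-1 - k conjugations by the chain, wraps around to
    s 0 in two more, and climbs back to s k in the remaining k. *)
Lemma full_twist_comm k : k < m -> commute full_twist (s k).
Proof.
move=> km; have m_gt0 : 0 < m by lia.
have -> : full_twist = chain ^+ k * (chain ^+ 2 * chain ^+ (m.-1 - k)).
  by rewrite -!expgnDr; congr (_ ^+ _); lia.
rewrite /commute -!mulgA chain_shiftX; last by lia.
have -> : k + (m.-1 - k) = m.-1 by lia.
have wrap x : chain * (chain * (s m.-1 * x)) = s 0 * (chain * (chain * x)).
  by rewrite !mulgA chain2_wrap // !mulgA.
by rewrite wrap [LHS]mulgA chain_shiftX // -mulgA.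
Qed.

(** The chain is a multiple of s 0, and moving s 0 to the left across k further
    factors turns it into s k. *)
Lemma ldvd_full_twist k : k < m -> ldvd (s k) full_twist.
Proof.
move=> km; have m_gt0 : 0 < m by lia.
have chain_recl : chain = s 0 * \prod_(1 <= i < m) s i by rewrite -big_ltn.
exists (chain ^+ k * (\prod_(1 <= i < m) s i * chain ^+ (m - k))).
have -> : full_twist = chain ^+ k * (chain * chain ^+ (m - k)).
  by rewrite -expgS -expgnDr; congr (_ ^+ _); lia.
rewrite {2}chain_recl -mulgA [LHS]mulgA chain_shiftX //.
by rewrite -!mulgA.
Qed.

End FullTwist.

(** * Braid groups as groups of fractions *)

Section BraidGroup.

Variable n : nat.

Definition strand_adj : rel 'I_n.-1 :=
  fun i j => (i.+1 == j :> nat) || (j.+1 == i :> nat).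

Local Notation M := (artin_monoid strand_adj).
Local Notation G := (braid_group n).

Lemma strand_adj_sym : symmetric strand_adj.
Proof. by move=> i j; rewrite /strand_adj orbC. Qed.

Lemma strand_adj_triangle i j k :
  strand_adj i j -> strand_adj j k -> ~~ strand_adj i k.
Proof. by rewrite /strand_adj; lia. Qed.

Lemma central_multiple :
  exists D : M, exists e : 'I_n.-1 -> M,
    (forall x, commute D x) /\ (forall i, D = gen strand_adj i * e i).
Proof.
pose s k : M := oapp (gen strand_adj) 1 (insub k).
have sE (i : 'I_n.-1) : s i = gen strand_adj i by rewrite /s valK.
have s_comm k l : k.+1 < l < n.-1 -> commute (s k) (s l).
  move=> /andP[kl ln]; have kn : k < n.-1 by lia.
  have := @gen_comm _ strand_adj (Ordinal kn) (Ordinal ln) 1.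
  by rewrite -!sE !mulg1; apply; rewrite /strand_adj /=; lia.
have s_braid k : k.+1 < n.-1 -> s k * (s k.+1 * s k) = s k.+1 * (s k * s k.+1).
  move=> ln; have kn : k < n.-1 by lia.
  have := @gen_braid _ strand_adj (Ordinal kn) (Ordinal ln) 1.
  by rewrite -!sE !mulg1; apply; rewrite /strand_adj /= eqxx.
have /choice[e De] i : exists e, full_twist n.-1 s = gen strand_adj i * e.
  by rewrite -sE; apply: ldvd_full_twist.
exists (full_twist n.-1 s), e; split=> //.
elim/artin_ind => [|i x Dx]; first exact: commute1.
by apply: commuteM Dx; rewrite -sE; apply: full_twist_comm.
Qed.


Local Notation cl := (\pi_(presented_group (@artin_rel n))).

Definition pos_word (u : seq 'I_n.-1) : word 'I_n.-1 := [seq (i, false) | i <- u].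

Lemma word_equiv_pos u v :
  artin_equiv strand_adj u v ->
  word_equiv (@artin_rel n) (pos_word u) (pos_word v).
Proof.
elim=> {u v}.
- move=> i j; rewrite /strand_adj => nij.
  case: (ltngtP i j) => [ij|ji|/val_inj->]; last exact: word_equiv_refl.
    by apply/word_equiv_rel/artin_comm; lia.
  by apply/word_equiv_sym/word_equiv_rel/artin_comm; lia.
- move=> i j /orP[/eqP ij|/eqP ji].
    exact/word_equiv_rel/artin_braid.
  exact/word_equiv_sym/word_equiv_rel/artin_braid.
- by move=> u; exact: word_equiv_refl.
- by move=> u v _; exact: word_equiv_sym.
- by move=> v u w _ uv _ vw; exact: word_equiv_trans uv vw.
- move=> u u' v v' _ uu' _ vv'; rewrite /pos_word !map_cat.
  exact: word_equiv_cat.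
Qed.

Definition to_group (x : M) : G := cl (pos_word (repr x)).

Lemma to_group_mcl u : to_group (mcl _ u) = cl (pos_word u).
Proof. by apply/presented_eqP/word_equiv_pos; exact: repr_mcl. Qed.

Lemma to_groupM : {morph to_group : x y / x * y}.
Proof.
move=> x y; have [u ->] := mcl_surj x; have [v ->] := mcl_surj y.
by rewrite -mclM !to_group_mcl /pos_word map_cat; exact/esym/presented_mulE.
Qed.

Lemma strand_cancel (a : M) : injective (mul a).
Proof. exact: artin_cancel strand_adj_sym strand_adj_triangle _. Qed.

Section Fractions.

Variables (D : M) (e : 'I_n.-1 -> M).
Hypothesis D_central : forall x, commute D x.
Hypothesis D_e : forall i, D = gen strand_adj i * e i.

(** e i * gen i = gen i * e i: D commutes with gen i, and gen i cancels. *)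
Lemma D_eg i : D = e i * gen strand_adj i.
Proof.
by apply: (@strand_cancel (gen strand_adj i)); rewrite mulgA -D_e D_central.
Qed.

Lemma DX_central k x : commute (D ^+ k) x.
Proof. exact/commute_sym/commuteX/commute_sym. Qed.

(** By induction gen i * a divides gen i * D ^+ len a = D ^+ len a * gen i, and
    gen i divides D. *)
Lemma ldvd_DX (a : M) : ldvd a (D ^+ len a).
Proof.
elim/artin_ind: a => [|i a [b ab]].
  by exists (D ^+ len (1 : M)); rewrite mul1g.
exists (b * e i); rewrite lenM len_gen add1n expgSr ab (D_e i).
rewrite !mulgA; congr (_ * _).
by rewrite -(mulgA (gen _ i)) -ab; exact: DX_central.
Qed.

Lemma strand_lcm (a b : M) : exists m, is_lcm a b m.
Proof.
apply: (common_multiple_lcm strand_adj_sym strand_adj_triangle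
  (c := D ^+ (len a + len b))).
  have [c ac] := ldvd_DX a; exists (c * D ^+ len b).
  by rewrite mulgA -ac expgnDr.
have [c bc] := ldvd_DX b; exists (c * D ^+ len a).
by rewrite mulgA -bc addnC expgnDr.
Qed.

(** Centrality of D lets the group element of w be written as
    D^-(neg_count w) * numerator w, each inverse of gen i being D^-1 * e i. *)
Definition numerator (w : word 'I_n.-1) : M :=
  \prod_(a <- w) (if a.2 then e a.1 else gen strand_adj a.1).

Definition neg_count (w : word 'I_n.-1) : nat := count snd w.

Lemma numerator_cat u v : numerator (u ++ v) = numerator u * numerator v.
Proof. exact: big_cat. Qed.

(** Equality of fractions with central denominators, cross-multiplied. It is an
    equivalence relation because powers of D cancel, and a congruence because
    they are central; a relation of the presentation involves no denominator. *)
Lemma numerator_equiv u v : word_equiv (@artin_rel n) u v ->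
  D ^+ neg_count v * numerator u = D ^+ neg_count u * numerator v.
Proof.
elim=> {u v}.
- move=> u v [i j ij|i j ij]; rewrite /numerator /neg_count /=.
    rewrite !big_cons big_nil /=; congr (_ * _).
    by apply: gen_comm; rewrite /strand_adj; lia.
  rewrite !big_cons big_nil /=; congr (_ * _).
  by apply: gen_braid; rewrite /strand_adj ij eqxx.
- move=> [i b]; rewrite /numerator /neg_count !big_cons !big_nil /= mul1g !mulg1.
  by case: b => /=; rewrite expg1 -?D_e -?D_eg.
- by [].
- by move=> u v _ ->.
- move=> v u w _ IHuv _ IHvw; apply: (@strand_cancel (D ^+ neg_count v)).
  rewrite [LHS]mulgA (DX_central _ (D ^+ neg_count w)) -mulgA IHuv.
  rewrite [LHS]mulgA (DX_central _ (D ^+ neg_count u)) -mulgA IHvw.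
  by rewrite [LHS]mulgA (DX_central _ (D ^+ neg_count v)) -mulgA.
move=> u u' v v' _ IHu _ IHv; rewrite !numerator_cat /neg_count !count_cat.
have shuffle k l (x y : M) : D ^+ (k + l) * (x * y) = D ^+ k * x * (D ^+ l * y).
  by rewrite expgnDr -!mulgA (mulgA x) -(DX_central l x) !mulgA.
by rewrite !shuffle IHu IHv.
Qed.

Lemma numerator_pos u : numerator (pos_word u) = mcl strand_adj u.
Proof.
rewrite /numerator big_map /=.
by elim: u => [|i u IHu]; rewrite ?big_nil // big_cons IHu -mcl_cons.
Qed.

Lemma neg_count_pos u : neg_count (pos_word u) = 0%N.
Proof. by rewrite /neg_count count_map; elim: u. Qed.

Lemma to_group_inj : injective to_group.
Proof.
move=> x y; have [u ->] := mcl_surj x; have [v ->] := mcl_surj y.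
rewrite !to_group_mcl => /presented_eqP/numerator_equiv.
by rewrite !neg_count_pos !mul1g !numerator_pos.
Qed.

Lemma numerator_fraction w :
  to_group (D ^+ neg_count w) * (cl w : G) = to_group (numerator w).
Proof.
have to_group_gen i : to_group (gen _ i) = cl [:: (i, false)].
  exact: to_group_mcl.
elim: w => [|[i b] w IHw]; first by rewrite /numerator big_nil to_group_mcl mulg1.
have -> : cl ((i, b) :: w) = (cl [:: (i, b)] : G) * (cl w : G).
  exact/esym/presented_mulE.
have -> : numerator ((i, b) :: w) = (if b then e i else gen _ i) * numerator w.
  exact: big_cons.
rewrite to_groupM -IHw /neg_count /=; case: b => /=; last first.
  by rewrite -to_group_gen !mulgA -!to_groupM DX_central.
have -> : cl [:: (i, true)] = (to_group (gen _ i))^-1.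
  by rewrite to_group_gen; exact/esym/presented_invE.
rewrite add1n expgSr {2}(D_eg i) !to_groupM !mulgA mulgK.
by rewrite -!to_groupM DX_central.
Qed.

Lemma braid_fraction (x : G) : exists d p, to_group d * x = to_group p.
Proof.
exists (D ^+ neg_count (repr x)), (numerator (repr x)).
by rewrite -numerator_fraction reprK.
Qed.

End Fractions.
End BraidGroup.

Theorem corollary2p11 (n : nat) (hn : (1 <= n)%N) : torsion_free (braid_group n).
Proof.
have [D [e [D_central D_e]]] := central_multiple n.
apply: (@fractions_torsion_free _ (braid_group n) (@to_group n)).
- exact: to_groupM.
- exact: to_group_inj D_central D_e.
- exact: artin_conical.
- exact: strand_lcm D_central D_e.
- exact: braid_fraction D_central D_e.
Qed.
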